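(* A finite abelian group $G$ satisfies $\alpha(G)=\frac{3}{4}$ if and only if there is $n\in\mathbb{N}$ such that $G\cong\mathbb{Z}_2^n\times\mathbb{Z}_4$.
   Context: For a finite group $G$, $L_1(G)$ denotes the set (poset) of cyclic subgroups of $G$ (including the trivial subgroup), and $\alpha(G)=\frac{|L_1(G)|}{|G|}$. $\mathbb{Z}_m$ is the cyclic group of order $m$, and $\mathbb{N}$ includes $0$. *)

(* Defs.v *)
From mathcomp Require Import all_boot all_order all_algebra.
From mathcomp Require Import all_fingroup all_solvable.
Set Implicit Arguments.
Unset Strict Implicit.
Unset Printing Implicit Defensive.

Definition L1 (gT : finGroupType) (G : {group gT}) : {set {group gT}} :=
  [set H in subgroups G | cyclic H].

Definition alpha (gT : finGroupType) (G : {group gT}) : rat :=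
  (#|L1 G|%:R / #|G|%:R)%R.

(* The group law on {dffun _} and on pairs is
   componentwise, and the one on 'Z_m is addition modulo m. *)
Definition Z2n_Z4 (n : nat) : finGroupType :=
  ({dffun forall _ : 'I_n, 'Z_2} * 'Z_4)%type.

(* Main.v *)
Require Import Defs.
From mathcomp Require Import all_boot all_order all_algebra.
From mathcomp Require Import all_fingroup all_solvable.
From mathcomp Require Import zify.
Import GRing.Theory Num.Theory.

(** Write L for the subgroup of the x in G with x ^ 2 = 1. A cyclic group C of
order d has totient d generators, so G is the disjoint union, over its cyclic
subgroups C, of sets of totient #|C| elements. When d <= 2 the totient is 1, so
L contributes exactly as many cyclic subgroups as it has elements; when d > 2
the totient is at least 2. Hence 2 * #|L1 G| <= #|G| + #|L|, with equality
as soon as every element has order 1, 2 or 4.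

For abelian G this makes alpha G = 3 / 4 equivalent to L having index 2
([alpha_34P]). If alpha G = 3 / 4, the inequality gives #|G| <= 2 * #|L|; since
#|L| divides #|G|, the index of L is 1 or 2, and index 1 would make every
element an involution or trivial, so that alpha G = 1. Conversely, if L has
index 2 then every square lies in L, so G has exponent dividing 4 and the
equality case applies.

Finally, an abelian group in which L has index 2 is determined by its order
([isog_index2]): it has exponent 4, an element x of order 4 spans a direct
factor, and a complement K of <[x]> is elementary abelian ([index2_dprod]). The
group Z_2 ^ n x Z_4 has the index 2 property and order 2 ^ n * 4, and G has such
an order because #|K| is a power of 2. *)

Local Open Scope group_scope.

(** * Counting cyclic subgroups by their generators *)

(** Each element generates exactly one cyclic subgroup, whose order is the order
of the element. The predicate P on orders allows the count to be split between
small and large cyclic subgroups. *)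
Lemma sum_totient_L1 (gT : finGroupType) (G : {group gT}) (P : pred nat) :
  \sum_(C in L1 G | P #|C|) totient #|C| = #|[set x in G | P #[x]]|.
Proof.
rewrite -sum1dep_card (partition_big (fun x => <[x]>%G)
   (fun C => (C \in L1 G) && P #|C|)) => [|x /andP[Gx Px]]; last first.
  by rewrite !inE cycle_subG Gx cycle_cyclic.
apply: eq_bigr => C /andP[]; rewrite !inE => /andP[sCG /cyclicP[a defC]] PC.
rewrite defC -[#|_|]/#[a] totient_gen -sum1dep_card; apply: eq_bigl => x.
rewrite /generator -(val_eqE <[x]>%G) /= defC eq_sym.
case: eqP => [eqax | _]; last by rewrite andbF.
have Gx: x \in G by rewrite -cycle_subG eqax -defC.
by rewrite Gx andbT /order eqax -defC.
Qed.

Lemma Ldiv2_order (gT : finGroupType) (G : {group gT}) :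
  'Ldiv_2(G) = [set x in G | #[x] <= 2].
Proof.
apply/setP=> x; rewrite !inE -order_dvdn; congr (_ && _).
by case: #[x] (order_gt0 x) => [|[|[|n]]] // _; apply/negP=> /dvdn_leq; lia.
Qed.

Lemma card_Ldiv2_split (gT : finGroupType) (G : {group gT}) :
  #|G| = (#|'Ldiv_2(G)| + \sum_(C in L1 G | 2 < #|C|) totient #|C|)%N.
Proof.
rewrite sum_totient_L1 Ldiv2_order -[LHS](cardsID [set x | #[x] <= 2]).
by congr (_ + _)%N; apply: eq_card => x; rewrite !inE // -ltnNge andbC.
Qed.

Lemma card_L1_split (gT : finGroupType) (G : {group gT}) :
  #|L1 G| = #|'Ldiv_2(G)| + \sum_(C in L1 G | 2 < #|C|) 1.
Proof.
rewrite Ldiv2_order -(sum_totient_L1 _ _ (fun n => n <= 2)) -sum1_card.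
rewrite (bigID (fun C : {group gT} => #|C| <= 2)) /=.
congr (_ + _)%N; last by apply: eq_bigl => C; rewrite -ltnNge.
apply: eq_bigr => C /andP[_]; case: #|C| (cardG_gt0 C) => [|[|[|]]] //.
Qed.

(** Cyclic groups of order greater than 2 have at least two generators, since
a generator then differs from its inverse. *)
Lemma double_card_L1_le (gT : finGroupType) (G : {group gT}) :
  2 * #|L1 G| <= #|G| + #|'Ldiv_2(G)|.
Proof.
rewrite card_L1_split (card_Ldiv2_split _ G).
have: 2 * (\sum_(C in L1 G | 2 < #|C|) 1) <=
      \sum_(C in L1 G | 2 < #|C|) totient #|C|.
  by rewrite big_distrr; apply: leq_sum => C /andP[_] /=; rewrite totient_gt1.
lia.
Qed.

(** The only cyclic subgroups of order greater than 2 now have order 4, and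
they have exactly two generators, so the previous bound is attained. *)
Lemma double_card_L1_exponent4 (gT : finGroupType) (G : {group gT}) :
  exponent G %| 4 -> (2 * #|L1 G| = #|G| + #|'Ldiv_2(G)|)%N.
Proof.
move=> expG; rewrite card_L1_split (card_Ldiv2_split _ G).
suff: (2 * (\sum_(C in L1 G | 2 < #|C|) 1))%N =
      \sum_(C in L1 G | 2 < #|C|) totient #|C| by lia.
rewrite big_distrr; apply: eq_bigr => C /andP[].
rewrite !inE => /andP[sCG cycC] gt2C.
have: #|C| %| 4.
  by rewrite -(exponent_cyclic cycC) (dvdn_trans (exponentS sCG)).
by case: #|C| gt2C => [|[|[|[|[|n]]]]] // _ /dvdn_leq; lia.
Qed.

(** * The index of the elements of order at most 2 *)

(** The quotient by 'Ldiv_2(G) has order 2, so every square lies in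
'Ldiv_2(G), and hence every fourth power is trivial. *)
Lemma exponent4_index2 (gT : finGroupType) (G : {group gT}) : abelian G ->
  #|G| = (2 * #|'Ldiv_2(G)|)%N -> exponent G %| 4.
Proof.
move=> abG oG; pose L := Group (group_Ldiv 2 abG).
have sLG: L \subset G by apply: subsetIl.
have nsLG: L <| G by rewrite -sub_abelian_normal.
have oQ: #|G / L| = 2.
  by rewrite card_quotient ?normal_norm // -divgS // oG mulnK // (cardG_gt0 L).
apply/exponentP=> x Gx; have nLx := subsetP (normal_norm nsLG) x Gx.
have /LdivP[_]: x ^+ 2 \in L.
  by rewrite coset_idr ?groupX // morphX // -oQ expg_cardG ?mem_quotient.
by rewrite -expgM.
Qed.

(** This turns the rational equation on alpha into a condition that is visibly
invariant under isomorphism and that controls the structure of G. *)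
Lemma alpha_34P (gT : finGroupType) (G : {group gT}) : abelian G ->
  alpha G = (3%:R / 4%:R)%R <-> #|G| = (2 * #|'Ldiv_2(G)|)%N.
Proof.
move=> abG.
have -> : alpha G = (3%:R / 4%:R)%R <-> (#|L1 G| * 4 = 3 * #|G|)%N.
  rewrite /alpha; split=> [/eqP | e].
    rewrite eqr_div ?pnatr_eq0 -?lt0n ?cardG_gt0 // -!natrM eqr_nat.
    by move/eqP.
  by apply/eqP; rewrite eqr_div ?pnatr_eq0 -?lt0n ?cardG_gt0 // -!natrM e.
split=> [oL1 | oG]; last first.
  by have := double_card_L1_exponent4 _ _ (exponent4_index2 _ _ abG oG); lia.
have := double_card_L1_le _ G; have G_gt0 := cardG_gt0 G.
have /dvdnP[k oG]: #|'Ldiv_2(G)| %| #|G|.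
  by apply: (@cardSg _ G (Group (group_Ldiv 2 abG))); apply: subsetIl.
(* Index 1 means exponent dividing 2, where every element has its own cyclic
   subgroup. *)
have nexp: k <> 1%N.
  move=> k1; rewrite k1 mul1n in oG.
  have expG: exponent G %| 2.
    by rewrite -sub_Ldiv (_ : 'Ldiv_2(G) = G) //; apply/eqP;
       rewrite eqEcard subsetIl oG /=.
  have := double_card_L1_exponent4 _ _ (dvdn_trans expG (isT : 2 %| 4)); lia.
case: k oG nexp => [|[|[|k]]] //; nia.
Qed.

(** * Structure of the groups of index 2 type *)

(** An element x outside 'Ldiv_2(G) has order 4, the exponent of G, so <[x]> has
a complement K. The square of any y in K is trivial: otherwise y and x
lie in the same nontrivial coset of 'Ldiv_2(G), which forces y ^ 2 = x ^ 2, an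
element of K :&: <[x]> = 1. *)
Lemma index2_dprod (gT : finGroupType) (G : {group gT}) : abelian G ->
  #|G| = (2 * #|'Ldiv_2(G)|)%N ->
  exists x, exists K : {group gT},
    [/\ <[x]> \x K = G, #[x] = 4 & 2.-abelem K].
Proof.
move=> abG oG; pose L := Group (group_Ldiv 2 abG).
have sLG: L \subset G by apply: subsetIl.
have oL : #|G| = (2 * #|L|)%N by [].
have L_gt0 := cardG_gt0 L.
have expG := exponent4_index2 _ _ abG oG.
have [x Gx notLx]: exists2 x, x \in G & x \notin L.
  by apply/subsetPn/negP => /subset_leq_card; lia.
have ox: #[x] = 4.
  have: #[x] %| 4 by apply: dvdn_trans (dvdn_exponent Gx) expG.
  have: ~~ (#[x] %| 2).
    by apply: contra notLx; rewrite order_dvdn => /eqP x2; apply/LdivP.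
  case: #[x] => [|[|[|[|[|n]]]]] // _ /dvdn_leq; lia.
have exG: exponent G = 4.
  by apply/eqP; rewrite eqn_dvd expG -{1}ox dvdn_exponent.
have [|K /complP[tixK defG]] := splitsP (abelian_splits Gx _ abG).
  by rewrite exG.
have sKG: K \subset G by rewrite -defG mulG_subr.
exists x, K; split=> //.
  by rewrite dprodE //; apply: centSS (abG); rewrite ?cycle_subG.
apply: exponent2_abelem; apply/exponentP=> y Ky; have Gy := subsetP sKG y Ky.
have [/LdivP[] // | notLy] := boolP (y \in L).
have iL: #|G : L| = 2 by rewrite -divgS // oL mulnK.
have: y \in L :* x by rewrite (rcoset_index2 sLG iL) in_setD ?notLy ?notLx.
rewrite mem_rcoset => /LdivP[_].
rewrite expgMn; last by apply: (centsP abG); rewrite ?groupV.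
move/eqP; rewrite expgVn -eq_mulgV1 => /eqP y2x2.
by apply/set1gP; rewrite -tixK inE {1}y2x2 mem_cycle groupX.
Qed.

(** In both groups the cyclic factor has order 4, so the elementary abelian
factors have equal orders and are isomorphic too. *)
Lemma isog_index2 (gT rT : finGroupType) (G : {group gT}) (H : {group rT}) :
  abelian G -> abelian H ->
  #|G| = (2 * #|'Ldiv_2(G)|)%N -> #|H| = (2 * #|'Ldiv_2(H)|)%N -> #|G| = #|H| ->
  G \isog H.
Proof.
move=> abG abH oG oH eqGH.
have [x [K [defG ox abelK]]] := index2_dprod _ _ abG oG.
have [y [M [defH oy abelM]]] := index2_dprod _ _ abH oH.
apply: (isog_dprod defG defH).
  by rewrite isog_cyclic_card ?cycle_cyclic //= -![#|<[_]>|]/#[_] ox oy.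
rewrite (isog_abelem_card _ abelK) abelM /=; apply/eqP.
have := dprod_card defG; have := dprod_card defH.
rewrite -[#|<[x]>|]/#[x] -[#|<[y]>|]/#[y] ox oy eqGH => <- /eqP.
by rewrite eqn_pmul2l // => /eqP.
Qed.

(** * The model group *)

Lemma abelian_Z2n_Z4 n : abelian [set: Z2n_Z4 n].
Proof.
apply/centsP=> -[f z] _ [g w] _; congr pair; last exact: Zp_mulgC.
by apply/ffunP=> i; rewrite !mulg_ffun; apply: Zp_mulgC.
Qed.

Lemma card_Z2n_Z4 n : #|[set: Z2n_Z4 n]| = (2 ^ n * 4)%N.
Proof. by rewrite cardsT card_prod card_ffun !card_ord. Qed.

(** The equation x ^ 2 = 1 is no constraint on the Z_2 components and leaves 0
and 2 in Z_4. *)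
Lemma card_Ldiv2_Z2n_Z4 n : #|'Ldiv_2([set: Z2n_Z4 n])| = (2 ^ n * 2)%N.
Proof.
have -> : 'Ldiv_2([set: Z2n_Z4 n]) = setX setT 'Ldiv_2([set: 'Z_4]).
  apply/setP=> -[f z]; rewrite !inE !expg2 -[_ * _]/((f * f), (z * z)) xpair_eqE.
  rewrite (_ : f * f == 1 = true) //; apply/eqP/ffunP=> i.
  rewrite mulg_ffun oneg_ffun -expg2.
  by case: (f i) => [[|[|m]]] //= ?; apply: val_inj.
rewrite cardsX cardsT card_ffun !card_ord; congr (_ * _)%N.
have -> : 'Ldiv_2([set: 'Z_4]) = [set 0%R; 2%:R%R].
  by apply/setP=> -[[|[|[|[|m]]]]] //= lt_m; rewrite !inE.
by rewrite cards2.
Qed.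

Theorem theorem2p3 (gT : finGroupType) (G : {group gT}) (abG : abelian G) :
  alpha G = (3%:R / 4%:R)%R <-> exists n : nat, G \isog [set: Z2n_Z4 n].
Proof.
rewrite alpha_34P //; split=> [oG | [n /isogP[f injf imf]]]; last first.
  have fLdiv: #|'Ldiv_2(G)| = #|'Ldiv_2([set: Z2n_Z4 n])|.
    by rewrite -imf -injm_Ldiv // card_injm // subsetIl.
  rewrite fLdiv card_Ldiv2_Z2n_Z4 -(card_injm injf) // [f @* G]imf card_Z2n_Z4.
  lia.
have [x [K [defG ox abelK]]] := index2_dprod _ _ abG oG.
have [n oK] := p_natP (abelem_pgroup abelK).
exists n; apply: isog_index2 => //; first exact: abelian_Z2n_Z4.
  by rewrite card_Z2n_Z4 card_Ldiv2_Z2n_Z4; lia.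
by rewrite card_Z2n_Z4 -(dprod_card defG) oK -[#|<[x]>|]/#[x] ox mulnC.
Qed.
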